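(* Let $r\ge2$ and let $g:R_r\to R_r$ be a train track map with exactly one nondegenerate illegal turn, representing some $\phi\in\mathrm{Out}(F_r)$. Then there exist $p\ge1$ and a decomposition \[g^p=g_{\theta_n}\circ\dots\circ g_{\theta_1}\] (equality up to isotopy relative to the vertex of $R_r$), where $\theta_1,\dots,\theta_n$ is a cyclically admissible sequence of elementary Nielsen automorphisms of $F_r$.
   Context: $F_r$ is the free group with fixed free basis $A=\{a_1,\dots,a_r\}$. An elementary Nielsen automorphism $\theta=[x\mapsto yx]$ (where $x,y\in A^{\pm1}$, $y\ne x^{\pm1}$) is the automorphism with $\theta(x)=yx$ and $\theta(z)=z$ for $z\in A^{\pm1}\setminus\{x,x^{-1}\}$. An ordered pair $([x\mapsto yx],[x'\mapsto y'x'])$ is admissible if either $x'=x$ and $y'\ne y^{-1}$, or $y'=x$ and $x'\ne y^{-1}$. A sequence $\theta_1,\dots,\theta_n$ ($n\ge 1$) is admissible if $(\theta_i,\theta_{i+1})$ is admissible for all $1\le i<n$, and cyclically admissible if also $(\theta_n,\theta_1)$ is admissible. The rose $R_r$ is the wedge of $r$ loop-edges labelled $a_1,\dots,a_r$ at a single vertex $v$, with $\pi_1(R_r,v)=F_r$; its oriented edges are identified with $A^{\pm1}$ (inverse = reversed orientation). A graph map $f:R_r\to R_r$ is a continuous map fixing $v$ and sending each oriented edge $e$ to an edge-path $f(e)=e_1\dots e_k$, $k\ge1$ (affinely on the subsegments mapped to the $e_i$). For $\theta=[x\mapsto yx]$, $g_\theta:R_r\to R_r$ is the graph map sending the edge $x$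 to the edge-path $yx$ and every edge $z\ne x^{\pm1}$ to $z$. The derivative map is $Df(e)=e_1$. A turn is an unordered pair of oriented edges of $R_r$; it is degenerate if the two coincide. A nondegenerate turn is legal for $f$ if all its images under $(Df)^k$, $k\ge1$, are nondegenerate; a turn is illegal if it is not legal. A graph map $f:R_r\to R_r$ is a train track map if it is a homotopy equivalence and for all $k\ge1$ and every edge $e$ the edge-path $f^k(e)$ is reduced. Equality of graph maps up to isotopy relative to the vertex means that the two maps send each edge to the same combinatorial edge-path. *)

(* Defs.v *)
From HB Require Import structures.
From mathcomp Require Import all_boot.

Set Implicit Arguments.
Unset Strict Implicit.
Unset Printing Implicit Defensive.

(* Oriented edges of the rose R_r, i.e. elements of A^{+-1}: (i, false) is the *)
(* generator a_i and (i, true) its inverse.                                   *)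
Definition edge (r : nat) : finType := ('I_r * bool)%type.

Definition einv (r : nat) (e : edge r) : edge r := (e.1, ~~ e.2).

(* R_r has a single vertex, so every sequence of oriented edges is an         *)
(* edge-path; it need not be reduced.                                         *)
Definition epath (r : nat) := seq (edge r).

Definition pinv (r : nat) (p : epath r) : epath r := rev (map (@einv r) p).

Definition reduced (r : nat) (p : epath r) : bool :=
  sorted (fun e e' => e' != einv e) p.

Definition redcons (r : nat) (e : edge r) (p : epath r) : epath r :=
  if p is e' :: p' then if e' == einv e then p' else e :: p else [:: e].

Definition reduce (r : nat) (p : epath r) : epath r := foldr (@redcons r) [::] p.

Section Words.
Variable r : nat.
Implicit Types (e : edge r) (p q : epath r).

Lemma einvK : involutive (@einv r).
Proof. by case=> i b; rewrite /einv /= negbK. Qed.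

Lemma einv_neq e : einv e != e.
Proof. by case: e => i b; rewrite /einv xpair_eqE eqxx /=; case: b. Qed.

Lemma pinvK : involutive (@pinv r).
Proof. by move=> p; rewrite /pinv map_rev revK mapK //; apply: einvK. Qed.

Lemma pinv_cat p q : pinv (p ++ q) = pinv q ++ pinv p.
Proof. by rewrite /pinv map_cat rev_cat. Qed.

Lemma pinv_flatten (s : seq (epath r)) :
  pinv (flatten s) = flatten (rev (map (@pinv r) s)).
Proof.
elim: s => [//|p s IHs] /=.
by rewrite pinv_cat IHs rev_cons flatten_rcons.
Qed.

Lemma redcons_reduced e p : reduced p -> reduced (redcons e p).
Proof.
case: p => [//|e' p] /= rp; case: ifP => [_|/negbT ne]; last by rewrite /reduced /= ne.
exact: path_sorted rp.
Qed.

Lemma foldr_reduced p q : reduced q -> reduced (foldr (@redcons r) q p).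
Proof. by move=> rq; elim: p => [//|e p IHp] /=; apply: redcons_reduced. Qed.

Lemma reduce_reduced p : reduced (reduce p).
Proof. exact: foldr_reduced. Qed.

Lemma reduce_id p : reduced p -> reduce p = p.
Proof.
elim: p => [//|e p IHp] rp /=; rewrite IHp; last exact: path_sorted rp.
by case: p rp {IHp} => [//|e' p] /= /andP[/negbTE -> _].
Qed.

Lemma redconsK e p : reduced p -> redcons e (redcons (einv e) p) = p.
Proof.
case: p => [|e' p] /=; first by rewrite eqxx.
rewrite einvK; case: (eqVneq e' e) => [-> | _ _] /=; last by rewrite eqxx.
by case: p => [//|e'' p] /= /andP[/negbTE -> _].
Qed.

Lemma foldr_redcons e p q : reduced q ->
  foldr (@redcons r) q (redcons e p) = redcons e (foldr (@redcons r) q p).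
Proof.
move=> rq; case: p => [//|e' p] /=; case: eqP => [->|//] /=.
by rewrite redconsK //; apply: foldr_reduced.
Qed.

Lemma foldr_reduce p q : reduced q ->
  foldr (@redcons r) q (reduce p) = foldr (@redcons r) q p.
Proof. by move=> rq; elim: p => [//|e p IHp] /=; rewrite foldr_redcons // IHp. Qed.

Lemma reduce_cat p q : reduce (reduce p ++ reduce q) = reduce (p ++ q).
Proof.
have E a b : reduce (a ++ b) = foldr (@redcons r) (reduce b) a by exact: foldr_cat.
by rewrite !E foldr_reduce ?reduce_reduced // reduce_id ?reduce_reduced.
Qed.

Lemma reduce_catV p : reduce (pinv p ++ p) = [::].
Proof.
rewrite /reduce foldr_cat -/(reduce p).
elim: p => [//|e p IHp].
rewrite -cat1s pinv_cat foldr_cat /= -/(reduce p).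
have := redconsK (einv e) (reduce_reduced p).
by rewrite einvK /pinv /rev /= => ->.
Qed.

End Words.

(* The free group F_r = pi_1(R_r, v): reduced words, i.e. homotopy classes    *)
(* (rel endpoints) of edge-paths of R_r.                                      *)
Record free_group (r : nat) :=
  FreeGroup { word :> epath r; word_reduced : reduced word }.

HB.instance Definition _ (r : nat) := [isSub for @word r].
HB.instance Definition _ (r : nat) := [Choice of free_group r by <:].

Definition path_class (r : nat) (p : epath r) : free_group r :=
  FreeGroup (reduce_reduced p).

Section FreeGroup.
Variable r : nat.
Implicit Types (u v w : free_group r) (p q : epath r).

Definition fg_one : free_group r := path_class [::].
Definition fg_mul u v : free_group r := path_class (word u ++ word v).
Definition fg_inv u : free_group r := path_class (pinv (word u)).

Lemma path_classK u : path_class (word u) = u.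
Proof. by apply: val_inj; rewrite /= reduce_id ?word_reduced. Qed.

Lemma path_class_cat p q :
  path_class (p ++ q) = fg_mul (path_class p) (path_class q).
Proof. by apply: val_inj; rewrite /= reduce_cat. Qed.

Fact fg_mulA : associative fg_mul.
Proof.
move=> u v w; rewrite -[u]path_classK -[v]path_classK -[w]path_classK.
by rewrite -!path_class_cat catA.
Qed.

Fact fg_mul1 : left_id fg_one fg_mul.
Proof. by move=> u; rewrite -[u]path_classK -path_class_cat. Qed.

Fact fg_mulr1 : right_id fg_one fg_mul.
Proof. by move=> u; rewrite -[u]path_classK -path_class_cat cats0. Qed.

Fact fg_mulV : left_inverse fg_one fg_inv fg_mul.
Proof.
move=> u; rewrite -[X in fg_mul _ X]path_classK -path_class_cat.
by apply: val_inj; rewrite /= reduce_catV.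
Qed.

Fact fg_mulrV : right_inverse fg_one fg_inv fg_mul.
Proof.
move=> u; rewrite -[X in fg_mul X _]path_classK -path_class_cat.
by apply: val_inj; rewrite /= -{1}[word u]pinvK reduce_catV.
Qed.

HB.instance Definition _ := isGroup.Build (free_group r)
  fg_mulA fg_mul1 fg_mulr1 fg_mulV fg_mulrV.

End FreeGroup.

(* A graph map R_r -> R_r fixing v, up to isotopy rel v: the nonempty         *)
(* edge-paths to which it sends the oriented edges.                           *)
Record graph_map (r : nat) := GraphMap {
  edge_image :> edge r -> epath r;
  edge_image_neq0 : forall e, edge_image e != [::];
  edge_image_inv : forall e, edge_image (einv e) = pinv (edge_image e)
}.

Definition gm_eq (r : nat) (f g : graph_map r) : Prop := forall e, f e = g e.

(* The edge-path f(p); no tightening is performed. *)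
Definition path_image (r : nat) (f : graph_map r) (p : epath r) : epath r :=
  flatten (map f p).

Section Composition.
Variables (r : nat) (f g : graph_map r).

Fact gm_id_neq0 (e : edge r) : [:: e] != [::]. Proof. by []. Qed.
Fact gm_id_inv (e : edge r) : [:: einv e] = pinv [:: e]. Proof. by []. Qed.
Definition gm_id : graph_map r := GraphMap gm_id_neq0 gm_id_inv.

Lemma path_image_inv (p : epath r) :
  path_image f (pinv p) = pinv (path_image f p).
Proof.
rewrite /path_image pinv_flatten /pinv map_rev -!map_comp; congr (flatten (rev _)).
by apply: eq_map => e /=; rewrite edge_image_inv.
Qed.

Fact gm_comp_neq0 e : path_image f (g e) != [::].
Proof.
have := edge_image_neq0 g e; case: (g e) => [//|e' p] _.
rewrite /path_image /=.
by have := edge_image_neq0 f e'; case: (f e').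
Qed.
Fact gm_comp_inv e : path_image f (g (einv e)) = pinv (path_image f (g e)).
Proof. by rewrite edge_image_inv path_image_inv. Qed.

(* f o g *)
Definition gm_comp : graph_map r := GraphMap gm_comp_neq0 gm_comp_inv.

End Composition.

Definition gm_pow (r : nat) (f : graph_map r) (k : nat) : graph_map r :=
  iter k (gm_comp f) (gm_id r).

(* The endomorphism of pi_1(R_r, v) = F_r induced by a graph map. *)
Definition pi1_map (r : nat) (f : graph_map r) (u : free_group r) :
    free_group r :=
  path_class (path_image f (word u)).

Section InducedMap.
Variable r : nat.
Implicit Types (f g : graph_map r) (p q : epath r).

Lemma pi1_map_class f p :
  pi1_map f (path_class p) = path_class (path_image f p).
Proof.
rewrite /pi1_map /=; elim: p => [//|e p IHp].
rewrite [in RHS]/path_image /= path_class_cat -/(path_image f p) -IHp.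
rewrite /= -path_class_cat; case: (reduce p) => [//|e' q] /=.
case: eqP => [->|//]; rewrite /path_image /= catA edge_image_inv.
rewrite path_class_cat.
suff -> : path_class (f e ++ pinv (f e)) = fg_one r.
  by rewrite fg_mul1.
by apply: val_inj; rewrite /= -{1}[f e]pinvK reduce_catV.
Qed.

Lemma pi1_mapM f : {morph pi1_map f : u v / (u * v)%g}.
Proof.
move=> u v; rewrite [LHS](pi1_map_class f) /path_image map_cat flatten_cat.
exact: path_class_cat.
Qed.

Lemma pi1_map_comp f g u : pi1_map (gm_comp f g) u = pi1_map f (pi1_map g u).
Proof.
rewrite [pi1_map g u]/pi1_map pi1_map_class; congr path_class.
by rewrite /path_image; elim: (word u) => [//|e p IHp] /=; rewrite map_cat flatten_cat IHp.
Qed.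

Lemma pi1_map_id f :
  (forall e, path_class (f e) = path_class [:: e]) -> pi1_map f =1 id.
Proof.
move=> fE u; rewrite -[RHS]path_classK /pi1_map /path_image.
elim: (word u) => [//|e p IHp] /=.
by rewrite -cat1s !path_class_cat IHp fE.
Qed.

HB.instance Definition _ f :=
  isMultiplicative.Build (free_group r) (free_group r) (pi1_map f)
    (pi1_mapM f).

End InducedMap.

(* Free homotopy of graph maps: w is the class of the loop traced by the      *)
(* vertex v, and each edge-path f(e) is homotopic rel endpoints to            *)
(* w f'(e) w^-1.                                                              *)
Definition homotopic (r : nat) (f f' : graph_map r) : Prop :=
  exists w : free_group r,
    forall e, path_class (f' e) = (path_class (f e) ^ w)%g.

Definition homotopy_equivalence (r : nat) (f : graph_map r) : Prop :=
  exists h : graph_map r,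
    homotopic (gm_comp h f) (gm_id r) /\ homotopic (gm_comp f h) (gm_id r).

Record aut (r : nat) := Aut {
  aut_fun :> {multiplicative free_group r -> free_group r};
  aut_bij : bijective aut_fun
}.

(* Elements of Out(F_r), as cosets of Inn(F_r) in Aut(F_r). *)
Record outer_aut (r : nat) := OuterAut {
  out_coset : aut r -> Prop;
  out_cosetP : exists phi : aut r, forall psi : aut r,
    out_coset psi <-> exists w : free_group r, forall u, psi u = (phi u ^ w)%g
}.

Definition represents (r : nat) (f : graph_map r) (Phi : outer_aut r) : Prop :=
  exists psi : aut r, out_coset Phi psi /\ forall u, pi1_map f u = psi u.

Definition train_track (r : nat) (f : graph_map r) : Prop :=
  homotopy_equivalence f /\
  forall k, 0 < k -> forall e, reduced (gm_pow f k e).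

Definition derivative (r : nat) (f : graph_map r) (e : edge r) : edge r :=
  head e (f e).

(* Turns are unordered pairs, encoded as sets {e, e'} with e = e' allowed. *)
Definition is_turn (r : nat) (T : {set edge r}) : Prop :=
  exists e e', T = [set e; e'].

Definition degenerate (r : nat) (T : {set edge r}) : Prop :=
  exists e, T = [set e].

Definition turn_image (r : nat) (f : graph_map r) (T : {set edge r}) :
    {set edge r} :=
  derivative f @: T.

Definition legal (r : nat) (f : graph_map r) (T : {set edge r}) : Prop :=
  ~ degenerate T /\ forall k, 0 < k -> ~ degenerate (iter k (turn_image f) T).

Definition one_nondegenerate_illegal_turn (r : nat) (f : graph_map r) : Prop :=
  exists! T : {set edge r}, [/\ is_turn T, ~ degenerate T & ~ legal f T].

(* The elementary Nielsen automorphism [x |-> yx]. *)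
Record nielsen (r : nat) := Nielsen {
  nx : edge r;
  ny : edge r;
  ny_neq : (ny != nx) && (ny != einv nx)
}.

Section NielsenMap.
Variables (r : nat) (theta : nielsen r).
Local Notation x := (nx theta).
Local Notation y := (ny theta).

Definition nielsen_image (z : edge r) : epath r :=
  if z == x then [:: y; x]
  else if z == einv x then [:: einv x; einv y]
  else [:: z].

Fact nielsen_image_neq0 z : nielsen_image z != [::].
Proof. by rewrite /nielsen_image; do 2?case: ifP. Qed.

Fact nielsen_image_inv z : nielsen_image (einv z) = pinv (nielsen_image z).
Proof.
rewrite /nielsen_image (inj_eq (can_inj (@einvK r))) (can2_eq (@einvK r) (@einvK r)).
case: (eqVneq z x) => [->|_]; first by rewrite eq_sym (negbTE (einv_neq x)).
by case: eqP => _ //; rewrite /pinv /= /rev /= !einvK.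
Qed.

(* The graph map g_theta. *)
Definition nielsen_map : graph_map r :=
  GraphMap nielsen_image_neq0 nielsen_image_inv.

Definition nielsen_aut : free_group r -> free_group r := pi1_map nielsen_map.

End NielsenMap.

Section NielsenAut.
Variable r : nat.
Implicit Type theta : nielsen r.
Local Notation gen z := (path_class [:: z]).

Lemma nielsen_autx theta :
  nielsen_aut theta (gen (nx theta)) = (gen (ny theta) * gen (nx theta))%g.
Proof.
rewrite /nielsen_aut pi1_map_class /path_image /= /nielsen_image eqxx.
exact: (path_class_cat [:: ny theta] [:: nx theta]).
Qed.

Lemma nielsen_autz theta z : z != nx theta -> z != einv (nx theta) ->
  nielsen_aut theta (gen z) = gen z.
Proof.
move=> /negbTE zx /negbTE zxV.
by rewrite /nielsen_aut pi1_map_class /path_image /= /nielsen_image zx zxV.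
Qed.

Fact nielsen_inv_neq theta :
  (einv (ny theta) != nx theta) && (einv (ny theta) != einv (nx theta)).
Proof.
rewrite (inj_eq (can_inj (@einvK r))) (can2_eq (@einvK r) (@einvK r)) andbC.
exact: ny_neq.
Qed.

Definition nielsen_inv theta : nielsen r := Nielsen (nielsen_inv_neq theta).

Lemma nielsen_image_reduced theta z : reduced (nielsen_image theta z).
Proof.
have /andP[yx yxV] := ny_neq theta.
rewrite /nielsen_image; case: ifP => _; last case: ifP => _ //.
  by rewrite /reduced /= eq_sym (can2_eq (@einvK r) (@einvK r)) yxV.
by rewrite /reduced /= einvK (can2_eq (@einvK r) (@einvK r)) yxV.
Qed.

Lemma nielsen_invK theta :
  cancel (nielsen_aut theta) (nielsen_aut (nielsen_inv theta)).
Proof.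
move=> u; rewrite /nielsen_aut -pi1_map_comp; apply: pi1_map_id => e.
have /andP[yx yxV] := ny_neq theta.
have [yVx yVxV] := andP (nielsen_inv_neq theta).
apply: val_inj; rewrite /= [nielsen_image theta e]/nielsen_image /path_image.
case: (eqVneq e (nx theta)) => [->|ex] /=.
  rewrite /nielsen_image /= (negbTE yx) (negbTE yxV) eqxx /= /redcons.
  by rewrite !einvK eq_sym (negbTE yx) /= eqxx.
case: (eqVneq e (einv (nx theta))) => [->|exV] /=.
  rewrite /nielsen_image /= (negbTE yVx) (negbTE yVxV) (negbTE (einv_neq _)) eqxx /=.
  by rewrite /redcons !einvK eqxx.
by rewrite /nielsen_image /= (negbTE ex) (negbTE exV).
Qed.

(* [x |-> yx] determines (x, y). *)
Lemma nielsen_aut_inj theta theta' :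
  nielsen_aut theta =1 nielsen_aut theta' ->
  nx theta = nx theta' /\ ny theta = ny theta'.
Proof.
move=> eqt; have /andP[yx yxV] := ny_neq theta.
have := congr1 val (eqt (gen (nx theta))).
rewrite /nielsen_aut !pi1_map_class /path_image /= !cats0.
rewrite !reduce_id ?nielsen_image_reduced // /nielsen_image eqxx.
case: ifP => [_ [-> ->] //|_]; case: ifP => [/eqP xE|//] [yE _].
by rewrite xE yE eqxx in yx.
Qed.

End NielsenAut.

Definition admissible (r : nat) (theta theta' : nielsen r) : bool :=
  ((nx theta' == nx theta) && (ny theta' != einv (ny theta))) ||
  ((ny theta' == nx theta) && (nx theta' != einv (ny theta))).

(* For s = [:: theta_1; ...; theta_n], [cycle] requires (theta_i, theta_i+1)  *)
(* for 1 <= i < n as well as (theta_n, theta_1).                              *)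
Definition cyclically_admissible (r : nat) (s : seq (nielsen r)) : Prop :=
  0 < size s /\ cycle (@admissible r) s.

(* g_{theta_n} o ... o g_{theta_1} *)
Definition nielsen_comp (r : nat) (s : seq (nielsen r)) : graph_map r :=
  foldl (fun f theta => gm_comp (nielsen_map theta) f) (gm_id r) s.

(* Main.v *)
(* Since every collision of the derivative D of g is a nondegenerate illegal   *)
(* turn, D identifies the two edges a, b of the unique illegal turn and is     *)
(* otherwise injective.  Strip the common prefix of g(a) and g(b): if both     *)
(* remainders were nonempty, the images of edges would form a Nielsen reduced  *)
(* system, so that images of reduced words would be at least as long as the    *)
(* words; as g is onto on F_r, all edges would then have images of length 1, a *)
(* contradiction.  Hence one of a, b folds completely over the other, that is, *)
(* g = f1 o g_theta with theta = [b |-> ab] or [a |-> ba].  The derivative of  *)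
(* f1 is injective off x = nx theta, and reducedness of g(x) says that x is    *)
(* not identified with the inverse of y = ny theta; so f1 is either a          *)
(* permutation sigma of the oriented edges or folds again, along a pair which  *)
(* makes the next theta admissible.  By induction on the total length of the   *)
(* images, g = sigma o h_s with s = theta_1, ..., theta_n admissible.          *)
(* The image of D contains neither sigma(nx theta_n) nor both of a and b, and  *)
(* misses one edge only, so sigma(nx theta_n) lies in the illegal turn.  As    *)
(* the path sigma(y x) is crossed by g(x), it makes a legal turn.  Hence       *)
(* (theta_n, sigma^-1 theta_1 sigma) is admissible, and expanding              *)
(* (sigma o h_s)^p, for p the order of sigma, and moving all factors sigma to  *)
(* the left yields the cyclically admissible sequence.                         *)

Require Import Defs.
From mathcomp Require Import all_boot.
From mathcomp Require Import fingroup perm zify.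

Set Implicit Arguments.
Unset Strict Implicit.
Unset Printing Implicit Defensive.

(** A map whose derivative identifies only one pair of edges can be unfolded. If neither image of
    the pair were an initial segment of the other, a Nielsen cancellation argument
    ([nielsen_reduced_onto]) would force every image to be a single edge; so [fold_step] splits off
    a factor [x -> yx], leaving a shorter map. What is left folds only at x, and reducedness
    excludes the pair x, y^-1: these are the conditions for the next factor to be admissible.
    [fold_decomposition] repeats this down to a permutation [t]. Uniqueness of the illegal turn
    ([missed_edge]) and reducedness of g^2 then make the last factor and the conjugated first one an
    admissible pair, and the power given by the order of [t] absorbs [t] ([gm_pow_twist],
    [cycle_twist_iter]). *)

(** * Cancellation in words *)

Section Cancellation.
Variable r : nat.
Implicit Types (e : edge r) (p q w : epath r).

Lemma size_pinv p : size (pinv p) = size p.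
Proof. by rewrite /pinv size_rev size_map. Qed.

Lemma reduced_pinv p : reduced (pinv p) = reduced p.
Proof.
rewrite /reduced /pinv rev_sorted sorted_map; apply: eq_sorted => e e' /=.
by rewrite (inj_eq (can_inj (@einvK r))) eq_sym (can2_eq (@einvK r) (@einvK r)).
Qed.

Lemma reduced_catr p q : reduced (p ++ q) -> reduced q.
Proof.
by case: p => //= e p; rewrite /reduced /= cat_path => /andP[_ /path_sorted].
Qed.

Definition diverge p q : bool :=
  if p is e :: _ then if q is e' :: _ then e != e' else true else true.

Lemma common_prefix p q :
  exists w p' q', [/\ p = w ++ p', q = w ++ q' & diverge p' q'].
Proof.
elim: p q => [|e p IHp] [|e' q].
- by exists [::], [::], [::].
- by exists [::], [::], (e' :: q).
- by exists [::], (e :: p), [::].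
case: (eqVneq e e') => [<-|ne]; last by exists [::], (e :: p), (e' :: q).
have [w [p' [q' [-> -> d]]]] := IHp q.
by exists (e :: w), p', q'.
Qed.

Lemma diverge_prefix p q w w' : diverge p q ->
  prefix w' (w ++ p) -> prefix w' (w ++ q) -> size w' <= size w.
Proof.
move=> d; elim: w w' => [|e w IHw] [|e' w'] //=; last first.
  by move=> /andP[_ wp] /andP[_ wq]; apply: IHw.
case: p q d => [//|e p] [//|e1 q] /= ne /andP[/eqP -> _].
by rewrite (negbTE ne).
Qed.

Lemma reduced_pinv_cat p q :
  reduced p -> reduced q -> diverge p q -> reduced (pinv p ++ q).
Proof.
case: p => [//|e p]; rewrite -reduced_pinv /pinv /= rev_cons cat_rcons.
rewrite /reduced; case: (rev _) => [|e1 p1] /=.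
  by case: q => //= e' q _ -> /=; rewrite einvK eq_sym => ->.
rewrite rcons_path cat_path /= => /andP[-> ->] /=.
by case: q => //= e' q ->; rewrite einvK eq_sym => ->.
Qed.

Lemma reduce_pinv_cat w p q : reduced p -> reduced q -> diverge p q ->
  reduce (pinv (w ++ p) ++ (w ++ q)) = pinv p ++ q.
Proof.
move=> rp rq d; rewrite pinv_cat -catA -reduce_cat.
rewrite [pinv w ++ _]catA -[X in _ ++ X]reduce_cat reduce_catV cat0s.
by rewrite [reduce (reduce q)]reduce_id ?reduce_reduced // reduce_cat
           reduce_id // reduced_pinv_cat.
Qed.

(* Otherwise the middle of p is a letter equal to its own inverse, or a pair of *)
(* adjacent inverse letters.                                                   *)
Lemma reduced_palindrome p k : reduced p -> p != [::] ->
  take k p = take k (pinv p) -> k.*2 < size p.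
Proof.
move: p => s rs s0 ks; have s_gt0 : 0 < size s by case: (s) s0.
have [e0 _] : exists e0, e0 \in s by case: (s) s0 => // e0 p; exists e0; apply: mem_head.
rewrite ltnNge; apply/negP => lek.
have E i : i < k -> i < size s -> nth e0 s i = einv (nth e0 s (size s - i.+1)).
  move=> ik js; rewrite -(nth_take _ ik) ks nth_take // /pinv.
  by rewrite nth_rev size_map // (nth_map e0) // ltn_subrL.
have [h sz] : exists h, size s = odd (size s) + h.*2.
  by exists (size s)./2; rewrite odd_double_half.
case: (odd (size s)) sz => sz.
  have := E h; have -> : size s - h.+1 = h by lia.
  move=> /(_ ltac:(lia) ltac:(lia)) /esym/eqP.
  by rewrite (negbTE (einv_neq _)).
have := E h.-1; have -> : size s - h.-1.+1 = h.-1.+1 by lia.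
move=> /(_ ltac:(lia) ltac:(lia)) eqh.
have /(sortedP e0) := rs; move=> /(_ h.-1 ltac:(lia)).
by rewrite eqh einvK eqxx.
Qed.

End Cancellation.

(** * Nielsen reduced systems *)

Lemma prefix_comparable (T : eqType) (s s1 s2 : seq T) :
  prefix s1 s -> prefix s2 s -> size s1 <= size s2 -> prefix s1 s2.
Proof.
by rewrite !prefixE => /eqP s1E /eqP s2E le; rewrite -s2E take_takel ?s1E.
Qed.

(* [l e] bounds the part of [f e] that may cancel at its initial vertex; the   *)
(* hypothesis [l_lt] leaves at least one letter of every [f e] uncancelled.    *)
Section NielsenReduced.
Variables (r : nat) (f : graph_map r) (l : edge r -> nat).
Hypothesis f_red : forall e, reduced (f e).
Hypothesis l_lt : forall e, l e + l (einv e) < size (f e).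
Hypothesis l_prefix : forall e e' w,
  e != e' -> prefix w (f e) -> prefix w (f e') -> size w <= l e.

(** The prefix clause confines cancellation with a preceding edge to the surviving part of [f e].
    The surplus [l e] in the length bound pays for that cancellation, so each further edge gains a
    letter. *)
Lemma nielsen_reduced_size (e : edge r) (u : epath r) : reduced (e :: u) ->
  prefix (take (size (f e) - l (einv e)) (f e))
         (reduce (path_image f (e :: u)))
  /\ l e + size u < size (reduce (path_image f (e :: u))).
Proof.
elim: u e => [|e1 u IHu] e ru.
  rewrite /path_image /= cats0 reduce_id // addn0 prefix_take; split=> //.
  by apply: leq_ltn_trans (l_lt e); apply: leq_addr.
have /andP[ne ru'] : (e1 != einv e) && reduced (e1 :: u) by [].
have [] := IHu _ ru'; rewrite [path_image f (e :: _)]/path_image /= -/(path_image f _).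
set R := reduce _ => Rp Rs.
have eqR : reduce (f e ++ path_image f (e1 :: u)) = reduce (f e ++ R).
  by rewrite -reduce_cat -[in RHS]reduce_cat /R [in RHS](reduce_id (reduce_reduced _)).
have rR : reduced R by apply: reduce_reduced.
rewrite -[path_image f (e1 :: u)]/(f e1 ++ path_image f u) in eqR Rs Rp *.
rewrite {}eqR.
have [w [p [q [fe Rq d]]]] := common_prefix (f (einv e)) R.
have fE : f e = pinv p ++ pinv w by rewrite -pinv_cat -fe -edge_image_inv einvK.
have wf : prefix w (f (einv e)) by rewrite fe prefix_prefix.
set P := take _ (f e1) in Rp; have sP : l e1 < size P.
  by rewrite size_takel ?leq_subr // ltn_subRL addnC l_lt.
have Pf1 : prefix P (f e1) by apply: prefix_take.
have wR : prefix w R by rewrite Rq prefix_prefix.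
(* Were [w] to reach beyond [P], then [P], longer than [l e1], would be a common prefix of [f e1]
   and [f (einv e)]. *)
have wP : prefix w P.
  case/orP: (leq_total (size w) (size P)) => [le|le].
    exact: prefix_comparable wR Rp le.
  have Pw : prefix P w by apply: prefix_comparable Rp wR le.
  by have := l_prefix ne Pf1 (prefix_trans Pw wf); rewrite leqNgt sP.
have wf1 : prefix w (f e1) := prefix_trans wP Pf1.
have lw := l_prefix ne wf1 wf.
have lw' : size w <= l (einv e) by apply: l_prefix wf wf1; rewrite eq_sym.
have rp : reduced p by apply: (@reduced_catr _ w); rewrite -fe.
have rq : reduced q by apply: (@reduced_catr _ w); rewrite -Rq.
have -> : reduce (f e ++ R) = pinv p ++ q.
  by rewrite -[in f e](einvK e) edge_image_inv fe Rq reduce_pinv_cat.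
have sR : size R = size w + size q by rewrite Rq size_cat.
have sfe : size (f e) = size p + size w by rewrite fE size_cat !size_pinv.
have lt := l_lt e; rewrite sfe in lt *; split.
  rewrite fE takel_cat ?size_pinv; first exact/prefix_catl/prefix_take.
  by rewrite leq_subLR addnC leq_add2r.
rewrite size_cat size_pinv /=; move: lt lw lw' Rs; rewrite sR; clear.
move: (l e) (l e1) (l (einv e)) (size p) (size q) (size w) (size u).
lia.
Qed.

End NielsenReduced.

Section Rigidity.
Variables (r : nat) (f : graph_map r) (l : edge r -> nat).
Hypothesis f_red : forall e, reduced (f e).
Hypothesis l_lt : forall e, l e + l (einv e) < size (f e).
Hypothesis l_prefix : forall e e' w,
  e != e' -> prefix w (f e) -> prefix w (f e') -> size w <= l e.

(** Surjectivity provides a reduced word mapped to each letter; the length bound only allows a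
    single edge. So every letter is the image of an edge, and by counting all edges arise this
    way. *)
Lemma nielsen_reduced_onto : bijective (pi1_map f) -> forall e, size (f e) = 1.
Proof.
case=> h _ hK.
have fE z : exists e, f e = [:: z].
  have := congr1 val (hK (path_class [:: z])); rewrite /pi1_map /=.
  case: (h _) => [[|e u] ru] //= eqz; exists e.
  have [_] := nielsen_reduced_size f_red l_lt l_prefix ru; rewrite eqz /=.
  rewrite ltnS leqn0 addn_eq0 size_eq0 => /andP[_ /eqP u0].
  by move: eqz; rewrite u0 /path_image /= cats0 reduce_id.
have [k kE] := fin_all_exists fE.
have k_inj : injective k by move=> z z' eqk; have := kE z; rewrite eqk kE => -[].
move=> e; have [k' _ k'K] := injF_bij k_inj.
by rewrite -(k'K e) kE.
Qed.

End Rigidity.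

(** * Splitting off one elementary fold *)

Section Derivative.
Variable r : nat.
Implicit Types (f : graph_map r) (e : edge r).

Lemma edge_imageE f e : f e = derivative f e :: behead (f e).
Proof. by have := edge_image_neq0 f e; rewrite /derivative; case: (f e). Qed.

Lemma edge_image_rcons f e : exists p, f e = rcons p (einv (derivative f (einv e))).
Proof.
exists (pinv (behead (f (einv e)))).
rewrite -[in LHS](einvK e) edge_image_inv [in LHS]edge_imageE.
by rewrite /pinv /= rev_cons.
Qed.

Lemma reduced_junction p e e' q :
  reduced (rcons p e ++ e' :: q) -> e' != einv e :> edge r.
Proof. by rewrite /reduced cat_rcons sorted_cat_cons => /and3P[]. Qed.

Lemma derivative_inj_size1 f : (forall e, reduced (f e)) ->
  bijective (pi1_map f) -> injective (derivative f) -> forall e, size (f e) = 1.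
Proof.
move=> f_red f_bij D_inj; apply: (@nielsen_reduced_onto _ _ (fun=> 0)) => //.
  by move=> e; rewrite edge_imageE.
move=> e e' [//|e1 w] ne; rewrite edge_imageE [f e']edge_imageE !prefix_cons.
move=> /andP[/eqP -> _] /andP[/eqP eqD _].
by rewrite (D_inj _ _ eqD) eqxx in ne.
Qed.

Lemma pi1_map_eq f g : gm_eq f g -> pi1_map f =1 pi1_map g.
Proof. by move=> fg u; rewrite /pi1_map /path_image (eq_map fg). Qed.

Lemma nielsen_aut_bij (theta : nielsen r) : bijective (nielsen_aut theta).
Proof.
exists (nielsen_aut (nielsen_inv theta)); first exact: nielsen_invK.
move=> u; have := nielsen_invK (nielsen_inv theta) u.
suff E v : nielsen_aut (nielsen_inv (nielsen_inv theta)) v = nielsen_aut theta v.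
  by rewrite E.
apply: pi1_map_eq => e /=; rewrite /nielsen_image /=.
by rewrite einvK.
Qed.

(* What remains true of [f] after an elementary fold [x |-> y x] is split off: *)
(* [f] can only fold at [x], and never along the turn {x, y^-1}.               *)
Definition folded_at f (x y : edge r) : Prop :=
  {in predC1 x &, injective (derivative f)} /\
  derivative f x != derivative f (einv y).

End Derivative.

Section Unfold.
Variables (r : nat) (f : graph_map r) (b : edge r) (v : epath r).

(* The left factor f1 of f = f1 o [b |-> ab] when f(b) = f(a) v.               *)
Definition unfold_image (z : edge r) : epath r :=
  if z == b then v else if z == einv b then pinv v else f z.

Hypothesis v_neq0 : v != [::].

Fact unfold_image_neq0 z : unfold_image z != [::].
Proof.
rewrite /unfold_image; do 2?[case: ifP => // _]; last exact: edge_image_neq0.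
by rewrite -size_eq0 size_pinv size_eq0.
Qed.

Fact unfold_image_inv z : unfold_image (einv z) = pinv (unfold_image z).
Proof.
rewrite /unfold_image (inj_eq (can_inj (@einvK r))) (can2_eq (@einvK r) (@einvK r)).
case: (eqVneq z b) => [->|_]; first by rewrite eq_sym (negbTE (einv_neq b)).
by case: eqP => _; rewrite ?pinvK // edge_image_inv.
Qed.

Definition unfold_map : graph_map r := GraphMap unfold_image_neq0 unfold_image_inv.

Variable a : edge r.
Hypotheses (f_red : forall e, reduced (f e)) (f_bij : bijective (pi1_map f)).
Hypotheses (ab : a != b) (fb : f b = f a ++ v).

Lemma full_fold_neq : a != einv b.
Proof.
apply: contraNneq v_neq0 => aE; rewrite -size_eq0.
have := congr1 size fb; rewrite aE edge_image_inv size_cat size_pinv.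
by move/eqP; rewrite -[X in X == _]addn0 eqn_add2l eq_sym.
Qed.

Lemma full_fold_ny_neq : (a != b) && (a != einv b).
Proof. by rewrite ab full_fold_neq. Qed.

Definition full_fold : nielsen r := Nielsen full_fold_ny_neq.

Lemma unfold_mapE : gm_eq f (gm_comp unfold_map (nielsen_map full_fold)).
Proof.
have U z : z != b -> z != einv b -> unfold_image z = f z.
  by rewrite /unfold_image => /negbTE -> /negbTE ->.
have Ub : unfold_image b = v by rewrite /unfold_image eqxx.
have E : f b = path_image unfold_map (nielsen_image full_fold b).
  by rewrite /nielsen_image eqxx /path_image /= cats0 Ub U ?full_fold_neq.
move=> e /=; case: (eqVneq e b) => [-> //|eb].
case: (eqVneq e (einv b)) => [->|eb'].
  by rewrite nielsen_image_inv path_image_inv -E edge_image_inv.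
by rewrite /nielsen_image (negbTE eb) (negbTE eb') /path_image /= cats0 U.
Qed.

Lemma unfold_reduced e : reduced (unfold_map e).
Proof.
have rv : reduced v by apply: (@reduced_catr _ (f a)); rewrite -fb.
by rewrite /= /unfold_image; do 2?[case: ifP => // _]; rewrite reduced_pinv.
Qed.

Lemma unfold_bij : bijective (pi1_map unfold_map).
Proof.
have [h hK Kh] := nielsen_aut_bij full_fold.
apply: (@eq_bij _ _ (pi1_map f \o h)).
  by apply: bij_comp f_bij _; exists (nielsen_aut full_fold).
by move=> u; rewrite /= (pi1_map_eq unfold_mapE) pi1_map_comp [X in pi1_map _ X]Kh.
Qed.

Lemma unfold_size : \sum_e size (unfold_map e) < \sum_e size (f e).
Proof.
have fV : size (f (einv b)) = size (f b) by rewrite edge_image_inv size_pinv.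
have sfb : size v < size (f b) by rewrite fb size_cat edge_imageE /= addSn ltnS leq_addl.
rewrite (bigD1 b) //= [X in _ < X](bigD1 b) //= -addSn leq_add //.
  by rewrite /unfold_image eqxx.
apply: leq_sum => e /negbTE eb; rewrite /unfold_image eb; case: eqP => // ->.
by rewrite size_pinv fV ltnW.
Qed.

Lemma unfold_derivative e : e != b -> derivative unfold_map e = derivative f e.
Proof.
move=> /negbTE eb; rewrite /derivative /= /unfold_image eb; case: eqP => // ->.
rewrite edge_image_inv fb pinv_cat.
suff : pinv v != [::] by case: (pinv v).
by rewrite -size_eq0 size_pinv size_eq0.
Qed.

(** The inequality expresses that [f b] does not backtrack where the last edge of [f a] meets the
    first edge of [v]. *)
Lemma unfold_folded : {in predC1 b &, injective (derivative f)} ->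
  folded_at unfold_map b a.
Proof.
move=> Dinj; split.
  move=> e e' eb e'b; rewrite !unfold_derivative //; exact: Dinj.
rewrite (unfold_derivative (e := einv a)); last first.
  by rewrite (can2_eq (@einvK r) (@einvK r)) full_fold_neq.
have [p faE] := edge_image_rcons f a; have := f_red b.
rewrite fb faE /derivative /= /unfold_image eqxx.
case: (v) v_neq0 => [//|e' q] _ /reduced_junction.
by rewrite einvK.
Qed.

End Unfold.

Definition elementary_fold (r : nat) (f : graph_map r) (a b : edge r) : Prop :=
  exists (theta : nielsen r) (f1 : graph_map r),
    [/\ gm_eq f (gm_comp f1 (nielsen_map theta)),
        (nx theta, ny theta) = (a, b) \/ (nx theta, ny theta) = (b, a),
        (forall e, reduced (f1 e)) /\ bijective (pi1_map f1),
        \sum_e size (f1 e) < \sum_e size (f e)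
      & folded_at f1 (nx theta) (ny theta)].

Lemma fold_step (r : nat) (f : graph_map r) (a b : edge r) :
  (forall e, reduced (f e)) -> bijective (pi1_map f) ->
  a != b -> derivative f a = derivative f b ->
  {in predC1 b &, injective (derivative f)} ->
  elementary_fold f a b.
Proof.
move=> f_red f_bij ab Dab Dinj.
have full c d v : c != d -> f d = f c ++ v -> v != [::] ->
      {in predC1 d &, injective (derivative f)} ->
      (d, c) = (a, b) \/ (d, c) = (b, a) ->
    elementary_fold f a b.
  move=> cd fd v0 Dd dc; exists (full_fold v0 cd fd), (unfold_map f d v0); split=> //.
  - exact: unfold_mapE.
  - by split; [exact: unfold_reduced fd | exact: unfold_bij fd].
  - exact: unfold_size fd.
  - exact: unfold_folded fd Dd.
have [w [p [q [fa fb dpq]]]] := common_prefix (f a) (f b).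
case: (eqVneq q [::]) => [q0|q0].
  case: (eqVneq p [::]) => [p0|p0].
    have /(bij_inj f_bij) : pi1_map f (path_class [:: a]) = pi1_map f (path_class [:: b]).
      by rewrite !pi1_map_class /path_image /= !cats0 fa fb p0 q0.
    by case=> abE; rewrite abE eqxx in ab.
  have ba : b != a by rewrite eq_sym.
  apply: (full b a p ba) p0 _ _; [by rewrite fa fb q0 cats0 | | by left].
  (* Only [a] and [b] collide, so injectivity off [b] is also injectivity off [a]. *)
  move=> e e'; rewrite !inE => ea e'a.
  have sub c : c != a -> derivative f c = derivative f b -> c = b.
    by move=> ca Dc; apply: contraNeq ca => cb; rewrite -Dab in Dc; apply/eqP/Dinj.
  case: (eqVneq e b) => [-> /esym/(sub _ e'a) -> //|eb].
  case: (eqVneq e' b) => [-> /(sub _ ea) -> //|e'b]; exact: Dinj.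
case: (eqVneq p [::]) => [p0|p0].
  by apply: (full a b q); rewrite ?fa ?fb ?p0 ?cats0 //; right.
(* With both remainders nonempty, [w] bounds all cancellation. Rigidity then gives [f a] length 1,
   although [w] and [p] are both nonempty. *)
pose l e := if (e == a) || (e == b) then size w else 0.
have w0 : 0 < size w.
  rewrite lt0n size_eq0; apply: contraL dpq => /eqP w0.
  move: Dab; rewrite /derivative fa fb w0 /=.
  by case: (p) p0 => // e1 p1 _; case: (q) q0 => // e2 q1 _ /= ->; rewrite eqxx.
have wlt e : (e == a) || (e == b) -> size w < size (f e).
  case/orP=> /eqP ->; rewrite ?fa ?fb size_cat;
    by rewrite -[X in X < _]addn0 ltn_add2l lt0n size_eq0.
have wpre e : (e == a) || (e == b) -> take (size w) (f e) = w.
  by case/orP=> /eqP ->; rewrite ?fa ?fb take_size_cat.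
have : size (f a) = 1.
  apply: (@nielsen_reduced_onto _ _ l) => //.
    move=> e; rewrite /l; case: ifP => [eab|_]; last first.
      by case: ifP => [/wlt|_]; rewrite ?edge_image_inv ?size_pinv // edge_imageE.
    case: ifP => [eVab|_]; last by rewrite addn0 wlt.
    (* Here [a] and [b] are mutually inverse, so [f e] and its inverse both begin with [w]. *)
    rewrite addnn; apply: reduced_palindrome (f_red e) (edge_image_neq0 f e) _.
    by rewrite -edge_image_inv !wpre.
  move=> e e' [//|e1 w'] ne pe pe'.
  have De : derivative f e = derivative f e'.
    move: pe pe'; rewrite edge_imageE [f e']edge_imageE !prefix_cons.
    by move=> /andP[/eqP <- _] /andP[/eqP <- _].
  have [eE|eE] : (e = a /\ e' = b) \/ (e = b /\ e' = a).
  - case: (eqVneq e b) => [eb|eb].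
      right; split=> //; apply: Dinj; rewrite ?inE -?Dab //; first by rewrite -eb eq_sym.
      by rewrite Dab -eb.
    case: (eqVneq e' b) => [e'b|e'b].
      by left; split=> //; apply: Dinj; rewrite ?inE // Dab -e'b.
    by rewrite (Dinj _ _ _ _ De) ?eqxx in ne.
  - rewrite /l eE.1 eqxx; apply: (diverge_prefix dpq).
      by rewrite -fa -eE.1.
    by rewrite -fb -eE.2.
  rewrite /l eE.1 eqxx orbT; apply: (diverge_prefix dpq).
    by rewrite -fa -eE.2.
  by rewrite -fb -eE.1.
have p_gt0 : 0 < size p by rewrite lt0n size_eq0.
by have := leq_add w0 p_gt0; rewrite -size_cat -fa => /[swap] ->.
Qed.

(** * Iterated folding *)

Section Compositions.
Variable r : nat.
Implicit Types (f g h : graph_map r) (s : seq (nielsen r)) (p : epath r).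

Lemma path_image_cat f p q :
  path_image f (p ++ q) = path_image f p ++ path_image f q.
Proof. by rewrite /path_image map_cat flatten_cat. Qed.

Lemma path_image_comp f g p :
  path_image (gm_comp f g) p = path_image f (path_image g p).
Proof.
by elim: p => [//|e p IHp]; rewrite -cat1s !path_image_cat -IHp /path_image /= !cats0.
Qed.

Lemma path_image_id p : path_image (gm_id r) p = p.
Proof. by elim: p => [//|e p IHp]; rewrite -[in RHS]IHp. Qed.

Lemma gm_powSr f k e : gm_pow f k.+1 e = path_image (gm_pow f k) (f e).
Proof.
elim: k e => [|k IHk] e; first by rewrite /= path_image_id /path_image /= cats0.
by rewrite -[LHS]/(path_image f (gm_pow f k.+1 e)) IHk -path_image_comp.
Qed.

Lemma nielsen_comp_rcons s theta e :
  nielsen_comp (rcons s theta) e = path_image (nielsen_map theta) (nielsen_comp s e).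
Proof. by rewrite /nielsen_comp foldl_rcons. Qed.

Lemma nielsen_comp_cat s1 s2 e :
  nielsen_comp (s1 ++ s2) e = path_image (nielsen_comp s2) (nielsen_comp s1 e).
Proof.
elim/last_ind: s2 => [|s2 theta IH]; first by rewrite cats0 path_image_id.
rewrite -rcons_cat nielsen_comp_rcons IH -path_image_comp.
by congr flatten; apply: eq_map => z; rewrite nielsen_comp_rcons.
Qed.

Lemma nielsen_comp_cons theta s e :
  nielsen_comp (theta :: s) e = path_image (nielsen_comp s) (nielsen_map theta e).
Proof. by rewrite -cat1s nielsen_comp_cat /= /path_image /= cats0. Qed.

Lemma fold_decomposition f theta :
  (forall e, reduced (f e)) -> bijective (pi1_map f) ->
  folded_at f (nx theta) (ny theta) ->
  exists s h, [/\ path (@admissible r) theta s, gm_eq f (gm_comp h (nielsen_comp s)),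
    forall e, size (h e) = 1 & injective (derivative h)].
Proof.
have [N] := ubnP (\sum_e size (f e)).
elim: N f theta => // N IHN f theta ltN f_red f_bij [Dinj Dny].
case/boolP: [exists c, (c != nx theta) && (derivative f c == derivative f (nx theta))];
  last first.
  move=> /existsPn no_fold.
  have inj : injective (derivative f).
    have no c : derivative f c = derivative f (nx theta) -> c = nx theta.
      by move=> Dc; apply/eqP; move: (no_fold c); rewrite Dc eqxx andbT negbK.
    move=> e e' De; case: (eqVneq e (nx theta)) => [eE|ne].
      by rewrite eE; apply/esym/no; rewrite -De eE.
    case: (eqVneq e' (nx theta)) => [e'E|ne'].
      by rewrite e'E; apply: no; rewrite De e'E.
    exact: Dinj De.
  exists [::], f; split=> //; last exact: derivative_inj_size1.
  by move=> e; rewrite /= /path_image /= cats0.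
case/existsP=> c /andP[cx /eqP Dc].
have [theta' [f1 [fE nxy [f1_red f1_bij] lt folded]]] := fold_step f_red f_bij cx Dc Dinj.
have [|s [h [ps f1E h1 hD]]] := IHN f1 theta' _ f1_red f1_bij folded.
  by apply: leq_trans lt _.
exists (theta' :: s), h; split=> //.
  rewrite /= ps andbT /admissible.
  (* The new fold pairs [c] with [nx theta], in either role; both cases of admissibility then ask
     for the same inequality. *)
  have cy : c != einv (ny theta) by apply: contraNneq Dny => <-; rewrite Dc.
  by case: nxy => -[-> ->]; rewrite eqxx cy ?orbT.
move=> e; rewrite fE /= nielsen_comp_cons -path_image_comp.
by congr flatten; apply: eq_map.
Qed.

Lemma mem_nielsen_image (theta : nielsen r) e : e \in nielsen_image theta e.
Proof. by rewrite /nielsen_image; do 2?case: eqP => [->|_]; rewrite !inE eqxx ?orbT. Qed.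

(** Shows that a further factor [x -> yx] really meets an edge x, so that the path yx occurs in the
    image of x. *)
Lemma mem_nielsen_comp s e : e \in nielsen_comp s e.
Proof.
elim/last_ind: s => [|s theta IH]; first by rewrite mem_seq1.
rewrite nielsen_comp_rcons; apply/flattenP.
by exists (nielsen_image theta e); rewrite ?mem_nielsen_image //; apply: map_f.
Qed.

End Compositions.

(** * Conjugation by edge permutations, and powers *)

Section Conjugation.
Variables (r : nat) (t : edge r -> edge r).
Hypotheses (t_inj : injective t) (t_inv : forall e, t (einv e) = einv (t e)).
Implicit Types (theta : nielsen r) (s : seq (nielsen r)).

Fact nielsen_conj_neq theta :
  (t (ny theta) != t (nx theta)) && (t (ny theta) != einv (t (nx theta))).
Proof. by rewrite -t_inv !(inj_eq t_inj) ny_neq. Qed.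

Definition nielsen_conj theta : nielsen r := Nielsen (nielsen_conj_neq theta).

Lemma nielsen_conj_image theta e :
  nielsen_image (nielsen_conj theta) (t e) = map t (nielsen_image theta e).
Proof.
rewrite /nielsen_image /= -t_inv !(inj_eq t_inj).
by do 2?case: ifP => _ //=; rewrite !t_inv.
Qed.

Lemma nielsen_conj_comp s e :
  nielsen_comp (map nielsen_conj s) (t e) = map t (nielsen_comp s e).
Proof.
elim/last_ind: s => [//|s theta IH].
rewrite map_rcons !nielsen_comp_rcons IH /path_image map_flatten -!map_comp.
by congr flatten; apply: eq_map => z /=; rewrite nielsen_conj_image.
Qed.

Lemma nielsen_conj_admissible theta theta' :
  admissible (nielsen_conj theta) (nielsen_conj theta') = admissible theta theta'.
Proof. by rewrite /admissible /= -t_inv !(inj_eq t_inj). Qed.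

Lemma iter_nielsen_conj k theta : (forall e, iter k t e = e) ->
  iter k nielsen_conj theta = theta.
Proof.
move=> tk.
have E : nx (iter k nielsen_conj theta) = iter k t (nx theta) /\
         ny (iter k nielsen_conj theta) = iter k t (ny theta).
  by elim: k {tk} => //= k [-> ->].
move: E; rewrite !tk; case: (iter _ _ _) => x y xy /= [xE yE].
case: theta xE yE => x' y' xy' /= xE yE; subst x' y'.
by congr Nielsen; apply: bool_irrelevance.
Qed.

End Conjugation.

(* As h_q o sigma = sigma o h_(c q), (sigma o h_s)^k is sigma^k o h_q with      *)
(* q = s, c s, ..., c^(k-1) s.                                                 *)
Definition twist_iter (T : Type) (c : T -> T) (s : seq T) (k : nat) : seq T :=
  iter k (fun q => s ++ map c q) [::].

Lemma cycle_twist_iter (T : Type) (e : rel T) (c : T -> T) (x : T) (s : seq T) k :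
  (forall y z, e (c y) (c z) = e y z) -> path e x s -> e (last x s) (c x) ->
  iter k.+1 c x = x -> path.cycle e (twist_iter c (x :: s) k.+1).
Proof.
move=> ec ps el cx.
(* The induction lets the path end at [iter k.+1 c x]; periodicity then closes it. *)
suff P : path e x (rcons (s ++ map c (twist_iter c (x :: s) k)) (iter k.+1 c x)).
  by rewrite cx in P.
elim: k {cx} => [|k IHk]; first by rewrite /= cats0 rcons_path ps.
rewrite rcons_cat cat_path ps -[iter k.+2 c x]/(c (iter k.+1 c x)) -map_rcons /=.
rewrite el; move: IHk; apply: homo_path => y z.
by rewrite ec.
Qed.

Lemma gm_pow_twist (r : nat) (t u : edge r -> edge r) (u_inj : injective u)
    (u_inv : forall e, u (einv e) = einv (u e))
    (g : graph_map r) (s : seq (nielsen r)) k :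
  cancel u t -> cancel t u -> (forall e, g e = map t (nielsen_comp s e)) ->
  forall e, gm_pow g k e =
    map (iter k t) (nielsen_comp (twist_iter (nielsen_conj u_inj u_inv) s k) e).
Proof.
move=> ut tu gE; elim: k => [//|k IHk] e; rewrite gm_powSr gE nielsen_comp_cat.
rewrite /path_image map_flatten -!map_comp; congr flatten; apply: eq_map => z /=.
rewrite IHk -[in RHS](tu z) nielsen_conj_comp -map_comp.
by apply: eq_map => y; rewrite [RHS]iterSr ut.
Qed.

(** * The unique illegal turn *)

Section IllegalTurn.
Variables (r : nat) (g : graph_map r).
Local Notation D := (derivative g).

Lemma iter_turn_image k (e e' : edge r) :
  iter k (turn_image g) [set e; e'] = [set iter k D e; iter k D e'].
Proof. by elim: k => //= k ->; rewrite /turn_image imsetU1 imset_set1. Qed.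

Lemma degenerate_pair (e e' : edge r) : degenerate [set e; e'] <-> e = e'.
Proof.
split=> [[x xE]|->]; last by exists e'; rewrite setUid.
have : e \in [set e; e'] by rewrite set21.
have : e' \in [set e; e'] by rewrite set22.
by rewrite xE !inE => /eqP -> /eqP ->.
Qed.

(** Any collision of an iterate of [D] is a nondegenerate illegal turn, hence the given one. If [D]
    separated [a] and [b] it would be injective, and no iterate could collapse the turn. *)
Lemma illegal_turn_pair : one_nondegenerate_illegal_turn g ->
  exists a b : edge r, [/\ a != b, D a = D b &
    forall k e e', e != e' -> iter k.+1 D e = iter k.+1 D e' ->
      e = a /\ e' = b \/ e = b /\ e' = a].
Proof.
case=> T [[[a [b ->]] nd ill] uniq].
have ab : a != b by apply/eqP => ab; apply/nd/degenerate_pair.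
have uniq' k e e' : e != e' -> iter k.+1 D e = iter k.+1 D e' ->
    e = a /\ e' = b \/ e = b /\ e' = a.
  move=> ne De; have eqT : [set a; b] = [set e; e'].
    apply: uniq; split; first by exists e, e'.
      by rewrite degenerate_pair; apply/eqP.
    by case=> _ /(_ k.+1 isT); rewrite iter_turn_image degenerate_pair.
  have : e \in [set a; b] by rewrite eqT set21.
  have : e' \in [set a; b] by rewrite eqT set22.
  rewrite !inE => /orP[]/eqP e'E /orP[]/eqP eE; subst e e'; rewrite ?eqxx // in ne *.
    by right.
  by left.
exists a, b; split=> //; apply/eqP; apply: contra_notT ill => nD.
split=> // k _; rewrite iter_turn_image degenerate_pair => Dk.
suff inj : injective D.
  by elim: (k) Dk => [|j IHj] //= => [abE|/inj //]; rewrite abE eqxx in ab.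
move=> e e' De; apply/eqP; apply: contraNT nD => ne.
by case: (uniq' 0 e e' ne De) => -[<- <-]; rewrite De.
Qed.

Lemma derivative_inj_off (a b : edge r) :
  (forall k e e', e != e' -> iter k.+1 D e = iter k.+1 D e' ->
    e = a /\ e' = b \/ e = b /\ e' = a) ->
  {in predC1 b &, injective D}.
Proof.
move=> uniq e e'; rewrite !inE => eb e'b De; apply/eqP.
apply: contraT => ne; case: (uniq 0 e e' ne De) => -[eE e'E].
  by rewrite e'E eqxx in e'b.
by rewrite eE eqxx in eb.
Qed.

(** The image of [D] misses one edge only. Preimages of both [a] and [b] would collide under the
    second iterate, hence be [a] and [b] themselves, which [D] does not separate. *)
Lemma missed_edge (a b m : edge r) : a != b -> D a = D b ->
  (forall k e e', e != e' -> iter k.+1 D e = iter k.+1 D e' ->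
    e = a /\ e' = b \/ e = b /\ e' = a) ->
  (forall e, D e != m) -> m = a \/ m = b.
Proof.
move=> ab Dab uniq m_missed.
have Dinj := derivative_inj_off uniq.
have /cards1P[z missE] : #|~: (D @: predC1 b)| == 1.
  rewrite cardsCs setCK card_in_imset // cardC1 -subn1 subKn //.
  by rewrite (cardD1 b).
have missed e' : (forall e, D e != e') -> e' = z.
  move=> e'_missed; apply/eqP; rewrite -in_set1 -missE inE.
  by apply/imsetP => -[e _ e'E]; move: (e'_missed e); rewrite e'E eqxx.
rewrite (missed m m_missed).
case: (boolP [exists e, D e == a]) => [/existsP[e1 /eqP De1]|/existsPn a_missed].
  right; apply/esym/missed => e2; apply/eqP => De2.
  have e12 : e1 != e2 by apply: contraNneq ab => eE; rewrite -De1 -De2 eE.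
  have /uniq-/(_ e12) : iter 2 D e1 = iter 2 D e2 by rewrite /= De1 De2.
  by case=> -[e1E e2E]; move: ab; rewrite -De1 -De2 e1E e2E Dab eqxx.
by left; apply/esym/missed.
Qed.

End IllegalTurn.

(** * Closing the cycle *)

Lemma nielsen_derivative_neq (r : nat) (theta : nielsen r) (e : edge r) :
  derivative (nielsen_map theta) e != nx theta.
Proof.
have /andP[yx _] := ny_neq theta; rewrite /derivative /= /nielsen_image.
case: (eqVneq e (nx theta)) => [//|ex].
by case: (eqVneq e (einv _)) => // _; apply: einv_neq.
Qed.

Lemma derivative_comp (r : nat) (f g : graph_map r) e :
  derivative (gm_comp f g) e = derivative f (derivative g e).
Proof.
rewrite /derivative /= [in LHS](edge_imageE g) /path_image /=.
by rewrite [in LHS](edge_imageE f).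
Qed.

Theorem theorem6p5 (r : nat) (hr : 2 <= r) (g : graph_map r)
    (hg : train_track g) (hturn : one_nondegenerate_illegal_turn g)
    (Phi : outer_aut r) (hPhi : represents g Phi) :
  exists (p : nat) (s : seq (nielsen r)),
    [/\ 1 <= p, cyclically_admissible s & gm_eq (gm_pow g p) (nielsen_comp s)].
Proof.
have g_bij : bijective (pi1_map g).
  by have [psi [_ gE]] := hPhi; apply: eq_bij (aut_bij psi) _ (fun u => esym (gE u)).
have g_red e : reduced (g e).
  have [_ tt] := hg; have := tt 1 isT e.
  by rewrite gm_powSr path_image_id.
have [a [b [ab Dab uniq]]] := illegal_turn_pair hturn.
have Dinj := derivative_inj_off uniq.
have [theta [f1 [gE nxy [f1_red f1_bij] _ folded]]] := fold_step g_red g_bij ab Dab Dinj.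
have [s [h [ps f1E h1 h_inj]]] := fold_decomposition f1_red f1_bij folded.
pose t := perm h_inj; pose u := (t^-1)%g.
have hE e : h e = [:: t e].
  by have := h1 e; rewrite permE edge_imageE; case: (behead _).
have tV e : t (einv e) = einv (t e).
  by have := edge_image_inv h e; rewrite !hE => -[].
have ut : cancel u t by exact: permKV.
have tu : cancel t u by exact: permK.
have uV e : u (einv e) = einv (u e) by rewrite -[in LHS](ut e) -tV tu.
have u_inj : injective u by exact: perm_inj.
have himg p : path_image h p = map t p.
  by rewrite /path_image (eq_map hE); elim: p => //= e p ->.
have gtE e : g e = map t (nielsen_comp (theta :: s) e).
  rewrite gE nielsen_comp_cons -himg -path_image_comp /=.
  by congr flatten; apply: eq_map.
pose c := nielsen_conj u_inj uV.
have order_gt : 0 < #[t]%g by exact: order_gt0.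
have tp e : iter #[t]%g.-1.+1 t e = e.
  by rewrite prednK // -permX expg_order perm1.
have up e : iter #[t]%g.-1.+1 u e = e.
  by rewrite prednK // -permX expgVn expg_order invg1 perm1.
exists #[t]%g.-1.+1, (twist_iter c (theta :: s) #[t]%g.-1.+1); split=> //; last first.
  move=> e; rewrite (gm_pow_twist u_inj uV _ ut tu gtE).
  by rewrite -[RHS]map_id; apply: eq_map.
split=> //; apply: cycle_twist_iter => //; first exact: nielsen_conj_admissible.
  set theta_n := last theta s; set x := nx theta_n; set y := ny theta_n.
  have sE : theta :: s = rcons (belast theta s) theta_n by rewrite -lastI.
  have tx_missed e : derivative g e != t x.
    rewrite /derivative gtE sE edge_imageE [head _ _]/=.
    rewrite (inj_eq perm_inj) /nielsen_comp foldl_rcons derivative_comp.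
    exact: nielsen_derivative_neq.
  have [p1 [p2 gx]] : exists p1 p2, g x = p1 ++ t y :: t x :: p2.
    rewrite gtE sE nielsen_comp_rcons.
    have /path.splitPr[p1 p2] := mem_nielsen_comp (belast theta s) x.
    rewrite path_image_cat /path_image /= [nielsen_image _ x]/nielsen_image eqxx.
    by rewrite map_cat; do 2 eexists.
  (* Otherwise the second iterate of [g] would backtrack on [x], as [g x] crosses [t y], [t x]. *)
  have D_yx : derivative g (t x) != derivative g (einv (t y)).
    have [_ /(_ 2 isT x)] := hg; rewrite gm_powSr gx.
    have [q gy] := edge_image_rcons g (t y).
    rewrite (_ : path_image _ _ = path_image g (p1 ++ t y :: t x :: p2)); last first.
      by congr flatten; apply: eq_map => e; rewrite gm_powSr path_image_id.
    rewrite path_image_cat => /reduced_catr; rewrite /path_image /= gy edge_imageE.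
    by move=> /reduced_junction; rewrite einvK.
  have D_theta : derivative g (nx theta) = derivative g (ny theta).
    by case: nxy => -[-> ->].
  have -> : admissible theta_n (c theta) =
      ((nx theta == t x) && (ny theta != einv (t y))) ||
      ((ny theta == t x) && (nx theta != einv (t y))).
    by rewrite /admissible /= -tV !(can2_eq ut tu).
  (* The missed edge [t x] is one side of the illegal turn; the other side has the same derivative,
     so [D_yx] keeps it from being [einv (t y)]. *)
  have [txE|txE] : t x = nx theta \/ t x = ny theta.
  - have := missed_edge ab Dab uniq tx_missed.
    by case: nxy => -[-> ->] [->|->]; [left|right|right|left].
  - rewrite txE eqxx; apply/orP; left.
    by apply: contraNneq D_yx => <-; rewrite txE D_theta.
  rewrite txE eqxx; apply/orP; right.
  by apply: contraNneq D_yx => <-; rewrite txE D_theta.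
exact: iter_nielsen_conj.
Qed.
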